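(* Let $d\in\mathbb N_0$ and let $B_d=(b_{i,j})_{i,j=1}^{d+1}$ be the $(d+1)\times(d+1)$ matrix with $$b_{i,j}=\begin{cases}0 & \text{if } i>j,\\ a+b-1 & \text{if } i=j,\\ (2^{j-i}b+a)\binom{j-1}{i-1} & \text{if } i<j.\end{cases}$$ Then the following statements hold. (i) There exists a unique $(d+1)$-tuple $(b_0(d),b_1(d),\ldots,b_d(d))\in\mathbb R^{d+1}$ satisfying the matrix equation $$B_d\,(b_0(d),b_1(d),\ldots,b_d(d))^T=2\left(\binom{d}{0}2^d,\binom{d}{1}2^{d-1},\ldots,\binom{d}{d}2^0\right)^T.$$ (ii) Let $(b_0(d),b_1(d),\ldots,b_d(d))$ be the unique solution of the matrix equation in (i). Then the polynomials $F_{1,d}(x),G_{1,d}(x),H_{1,d}(x)$ defined by $$F_{1,d}(x)=\sum_{i=0}^{d}b_i(d)x^i,\qquad G_{1,d}(x)=-2(x+1)^d+b\sum_{i=0}^{d}b_i(d)(x+1)^i,$$ $$H_{1,d}(x)=2c_0+2^{d+1}c_1-(ac_1+bc_0)\sum_{i=0}^{d}b_i(d)-bc_1\sum_{i=0}^{d}2^ib_i(d)$$ ($H_{1,d}$ is a constant polynomial) satisfy, for all $n\in\mathbb N$, $$2\sum_{k=1}^{n}k^ds_{k-1}=F_{1,d}(n)s_{n+1}+G_{1,d}(n)s_n+H_{1,d}(n).$$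
   Context: $\mathbb N$ denotes the positive integers and $\mathbb N_0=\mathbb N\cup\{0\}$. Fix $a,b\in\mathbb N$ and $c_0,c_1\in\mathbb Z$ with $(c_0,c_1)\neq(0,0)$. The generalized Fibonacci sequence $(s_n)_{n\ge0}$ is defined by $s_0=c_0$, $s_1=c_1$, and $s_{n+1}=as_n+bs_{n-1}$ for all $n\in\mathbb N$. The number $b$, the matrix entries $b_{i,j}$ and the solution components $b_i(d)$ are distinct objects. *)

(* Defs.v *)
From mathcomp Require Import all_boot all_order all_algebra.
From mathcomp Require Import reals.

Set Implicit Arguments.
Unset Strict Implicit.
Unset Printing Implicit Defensive.

Import Order.TTheory GRing.Theory Num.Theory.

Local Open Scope ring_scope.

Fixpoint gfib (a b : nat) (c0 c1 : int) (n : nat) : int :=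
  match n with
  | 0%N => c0
  | n1.+1 =>
      match n1 with
      | 0%N => c1
      | n2.+1 => a%:Z * gfib a b c0 c1 n1 + b%:Z * gfib a b c0 c1 n2
      end
  end.

Lemma gfib_rec (a b : nat) (c0 c1 : int) (n : nat) : (0 < n)%N ->
  gfib a b c0 c1 n.+1 =
    a%:Z * gfib a b c0 c1 n + b%:Z * gfib a b c0 c1 n.-1.
Proof. by case: n. Qed.

Section Defs.
Variable R : realType.

(* Indices run from 0 to d instead of 1 to d + 1, so the binomial
   C(j-1, i-1) of the 1-based convention is 'C(j, i) here. *)
Definition Bmx (a b d : nat) : 'M[R]_d.+1 :=
  \matrix_(i, j)
    if (j < i)%N then 0
    else if i == j then a%:R + b%:R - 1
    else (2 ^+ (j - i) * b%:R + a%:R) * 'C(j, i)%:R.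

Definition rhs (d : nat) : 'rV[R]_d.+1 :=
  \row_(i < d.+1) ('C(d, i)%:R * 2 ^+ (d - i)).

Definition Bsol (a b d : nat) (beta : 'rV[R]_d.+1) : Prop :=
  Bmx a b d *m beta^T = 2 *: (rhs d)^T.

Definition F1 (d : nat) (beta : 'rV[R]_d.+1) : {poly R} :=
  \sum_(i < d.+1) beta 0 i *: 'X^i.

Definition G1 (b d : nat) (beta : 'rV[R]_d.+1) : {poly R} :=
  - 2 *: ('X + 1) ^+ d
  + b%:R *: \sum_(i < d.+1) beta 0 i *: ('X + 1) ^+ i.

Definition H1 (a b : nat) (c0 c1 : int) (d : nat) (beta : 'rV[R]_d.+1) :
    {poly R} :=
  (2 * c0%:~R + 2 ^+ d.+1 * c1%:~R
   - (a%:R * c1%:~R + b%:R * c0%:~R) * (\sum_(i < d.+1) beta 0 i)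
   - b%:R * c1%:~R * (\sum_(i < d.+1) 2 ^+ i * beta 0 i))%:P.

End Defs.

(* Main.v *)
(* With F = \sum_j beta_j X^j, the i-th row of the matrix equation says that both
   sides of  b F(x + 2) + a F(x + 1) - F(x) = 2 (x + 2)^d  have the same
   coefficient at x^i. Since G(x) = b F(x + 1) - 2 (x + 1)^d, this functional
   equation is exactly what makes F(n) s_(n+1) + G(n) s_n increase by
   2 (n + 1)^d s_n from n to n + 1; the constant H fits the case n = 1.
   Solvability is clear: the matrix is triangular with diagonal a + b - 1 > 0. *)
Require Import Defs.
From mathcomp Require Import all_boot all_order all_algebra.
From mathcomp Require Import reals ring.

Set Implicit Arguments.
Unset Strict Implicit.
Unset Printing Implicit Defensive.

Import Order.TTheory GRing.Theory Num.Theory.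

Local Open Scope ring_scope.

Lemma gfib_recR (R : pzRingType) (a b : nat) (c0 c1 : int) (n : nat) :
  (gfib a b c0 c1 n.+2)%:~R =
    a%:R * (gfib a b c0 c1 n.+1)%:~R + b%:R * (gfib a b c0 c1 n)%:~R :> R.
Proof. by rewrite gfib_rec // intrD !intrM. Qed.

(** The added terms vanish because ['C(n, i)] is zero for [n < i]. A range independent of [n] allows
    sums over several exponents to be exchanged. *)
Lemma exprDn_wide (R : comNzRingType) (x y : R) (n m : nat) : (n <= m)%N ->
  (x + y) ^+ n = \sum_(i < m.+1) x ^+ i * (y ^+ (n - i) * 'C(n, i)%:R).
Proof.
move=> le_nm; rewrite addrC exprDn.
rewrite (big_ord_widen m.+1 (fun i => y ^+ (n - i) * x ^+ i *+ 'C(n, i))) //.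
rewrite big_mkcond; apply: eq_bigr => i _; rewrite -mulr_natr.
case: ltnP => [_|lt_ni]; first by ring.
by rewrite bin_small // !mulr0.
Qed.

Section Equation.
Variables (R : realType) (a b d : nat).
Implicit Type beta : 'rV[R]_d.+1.

(** One formula covers the three cases: the binomial vanishes below the diagonal, and the [-1] on
    the diagonal becomes an identity matrix, the source of [- F(x)] in the functional equation. *)
Lemma BmxE (i j : 'I_d.+1) : Bmx R a b d i j =
  (2 ^+ (j - i) * b%:R + a%:R) * 'C(j, i)%:R - (i == j)%:R.
Proof.
rewrite mxE; case: ltnP => [lt_ji|_].
  by rewrite bin_small // -val_eqE gtn_eqF // mulr0 subr0.
by case: eqP => [->|_] /=; rewrite ?subnn ?binn ?subr0 //; ring.
Qed.

Lemma Bmx_unit : (0 < a)%N -> (0 < b)%N -> Bmx R a b d \in unitmx.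
Proof.
(* [det_trig] expects a lower triangular matrix, hence the transpose. *)
move=> a_gt0 b_gt0; rewrite unitmxE -det_tr det_trig; last first.
  by apply/is_trig_mxP => i j lt_ij; rewrite !mxE lt_ij.
rewrite unitfE; apply/prodf_neq0 => i _; rewrite !mxE ltnn eqxx.
by rewrite -natrD subr_eq0 -[1]/(1%:R) eqr_nat gtn_eqF // (leq_add a_gt0 b_gt0).
Qed.

Lemma horner_F1 beta x : (F1 beta).[x] = \sum_(i < d.+1) beta 0 i * x ^+ i.
Proof.
by rewrite horner_sum; apply: eq_bigr => i _; rewrite hornerZ hornerXn.
Qed.

Lemma horner_G1 beta x :
  (G1 b beta).[x] = - 2 * (x + 1) ^+ d + b%:R * (F1 beta).[x + 1].
Proof.
rewrite horner_F1 /G1 hornerD !hornerZ horner_sum horner_exp !hornerE.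
congr (_ + _ * _); apply: eq_bigr => i _.
by rewrite hornerZ horner_exp !hornerE.
Qed.

Lemma horner_H1 c0 c1 beta x : (H1 a b c0 c1 beta).[x] =
  2 * c0%:~R + 2 ^+ d.+1 * c1%:~R
  - (a%:R * c1%:~R + b%:R * c0%:~R) * (F1 beta).[1]
  - b%:R * c1%:~R * (F1 beta).[2].
Proof.
rewrite hornerC !horner_F1.
under [in RHS]eq_bigr do rewrite expr1n mulr1.
by under [X in _ = _ - _ * X]eq_bigr do rewrite mulrC.
Qed.

(** Expanding in powers of [x] exposes the coefficients to be compared with row [i] of the system,
    at [y = 2] and [y = 1]. *)
Lemma F1_shift beta (x y : R) : (F1 beta).[x + y] =
  \sum_(i < d.+1) x ^+ i *
    \sum_(j < d.+1) y ^+ (j - i) * 'C(j, i)%:R * beta 0 j.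
Proof.
rewrite horner_F1.
under eq_bigr => j _ do
  rewrite (exprDn_wide x y (ltn_ord j : (j <= d)%N)) mulr_sumr.
rewrite exchange_big; apply: eq_bigr => i _.
by rewrite mulr_sumr; apply: eq_bigr => j _; ring.
Qed.

Lemma F1_functional_eq beta x : Bsol a b beta ->
  b%:R * (F1 beta).[x + 2] + a%:R * (F1 beta).[x + 1] - (F1 beta).[x]
  = 2 * (x + 2) ^+ d.
Proof.
move=> sol; rewrite !F1_shift (exprDn_wide x 2 (leqnn d)) horner_F1.
rewrite !mulr_sumr -sumrN -!big_split /=; apply: eq_bigr => i _.
have /matrixP/(_ i 0) := sol; rewrite !mxE => row_i.
transitivity (x ^+ i * \sum_j Bmx R a b d i j * beta^T j 0); last first.
  by rewrite row_i; ring.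
have -> : \sum_j Bmx R a b d i j * beta^T j 0 =
    b%:R * (\sum_(j < d.+1) 2 ^+ (j - i) * 'C(j, i)%:R * beta 0 j)
    + a%:R * (\sum_(j < d.+1) 1 ^+ (j - i) * 'C(j, i)%:R * beta 0 j)
    - beta 0 i.
  have -> : beta 0 i = \sum_j (i == j)%:R * beta 0 j.
    rewrite (bigD1 i) //= eqxx mul1r big1 ?addr0 // => j.
    by rewrite eq_sym => /negPf->; rewrite mul0r.
  rewrite !mulr_sumr -sumrN -!big_split /=; apply: eq_bigr => j _.
  by rewrite BmxE mxE expr1n; ring.
by ring.
Qed.

End Equation.

Theorem theorem2p5 (R : realType) (a b : nat) (c0 c1 : int)
    (a_gt0 : (0 < a)%N) (b_gt0 : (0 < b)%N)
    (c_neq0 : (c0, c1) <> (0, 0)) (d : nat) :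
  (exists! beta : 'rV[R]_d.+1, Bsol a b beta) /\
  (forall beta : 'rV[R]_d.+1, Bsol a b beta ->
   forall n : nat, (0 < n)%N ->
     2 * (\sum_(1 <= k < n.+1) k%:R ^+ d * (gfib a b c0 c1 k.-1)%:~R) =
     (F1 beta).[n%:R] * (gfib a b c0 c1 n.+1)%:~R
     + (G1 b beta).[n%:R] * (gfib a b c0 c1 n)%:~R
     + (H1 a b c0 c1 beta).[n%:R] :> R).
Proof.
split.
  have unitB := Bmx_unit R d a_gt0 b_gt0.
  exists (invmx (Bmx R a b d) *m (2 *: (rhs R d)^T))^T; split.
    by rewrite /Bsol trmxK mulKVmx.
  by move=> beta sol; rewrite -sol mulKmx // trmxK.
move=> beta sol; case=> // n _; elim: n => [|n IHn].
  (* [exprS] splits [2 ^+ d.+1] in [H1] so that it cancels the term [- 2 * 2 ^+ d] of [G1] at 1. *)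
  rewrite big_nat1 expr1n mul1r horner_G1 horner_H1 -[1 + 1]/(2 : R) gfib_recR exprS.
  by ring.
rewrite big_nat_recr // mulrDr IHn !horner_G1 !horner_H1.
have := F1_functional_eq n.+1%:R sol.
have -> : n.+1%:R + 2 = n.+3%:R :> R by rewrite -natrD addn2.
rewrite !natr1.
(* Only [s_(n+3)] is expanded, leaving combinations of [s_(n+2)] and [s_(n+1)]: the coefficients of
   [s_(n+1)] agree by the form of [G1], those of [s_(n+2)] by [feq]. *)
rewrite [(gfib _ _ _ _ n.+3)%:~R]gfib_recR succnK => feq.
have -> : (F1 beta).[n.+1%:R] = b%:R * (F1 beta).[n.+3%:R]
    + a%:R * (F1 beta).[n.+2%:R] - 2 * n.+3%:R ^+ d by rewrite -feq; ring.
by ring.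
Qed.
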